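(* Let $\lambda_1(A_n)$ be the smallest eigenvalue of the $n\times n$ Toeplitz matrix $A_n = T_n(f_n)$, where $f_n(\theta)=\sum_{j=0}^{n-1} \left(\tfrac1n\right)^{j/n}|\theta|^{2-j/n}$ for $\theta\in[-\pi,\pi]$. Then $$n\,\lambda_1(A_n)\ge k_2+O\Big(\frac1n\Big)\quad\text{as } n\to\infty,$$ where $$k_2=\frac1\pi\int_0^\pi\frac{\sigma^2-\sigma}{\log(\sigma)}\,d\sigma,$$ which can be approximated numerically as $2.2945$. That is, there exist constants $C>0$ and $N\in\mathbb N$ such that $n\lambda_1(A_n)\ge k_2-\frac{C}{n}$ for all $n\ge N$.
   Context: For an integrable function $b:[-\pi,\pi]\to\mathbb R$, $T_n(b)$ denotes the $n\times n$ Toeplitz matrix with entries $(T_n(b))_{j,k}=\hat b_{j-k}$, $j,k=1,\dots,n$, where $\hat b_m=\frac{1}{2\pi}\int_{-\pi}^{\pi} b(\theta)e^{-\mathrm i m\theta}\,d\theta$. With $h=\frac1n$, the symbol is $f_n(\theta)=\sum_{j=0}^{n-1}h^{jh}|\theta|^{2-jh}$ (with $f_n(0)=0$). It is real-valued and even, so $A_n$ is real symmetric. Its eigenvalues are arranged in nondecreasing order $\lambda_1(A_n)\le\cdots\le\lambda_n(A_n)$. The integrand in the definition of $k_2$ is extended by continuity at $\sigma=0$ and $\sigma=1$; $\log$ is the natural logarithm. *)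

(* Defs.v *)
From HB Require Import structures.
From mathcomp Require Import all_boot all_order all_algebra.
From mathcomp Require Import all_classical all_reals all_analysis.
From mathcomp Require Import complex.

Set Implicit Arguments.
Unset Strict Implicit.
Unset Printing Implicit Defensive.

Import Order.TTheory GRing.Theory Num.Theory.

Local Open Scope classical_set_scope.
Local Open Scope ring_scope.
Local Open Scope complex_scope.

Section Toeplitz.
Variable R : realType.

Definition cexpi (t : R) : R[i] := cos t +i* sin t.

Definition Cintegral (D : set R) (F : R -> R[i]) : R[i] :=
  (\int[@lebesgue_measure R]_(x in D) complex.Re (F x)) +i*
  (\int[@lebesgue_measure R]_(x in D) complex.Im (F x)).

Definition fourier_coef (b : R -> R) (m : int) : R[i] :=
  ((2 * pi)^-1)%:C *
  Cintegral `[- pi, pi] (fun t => (b t)%:C * cexpi (- (m%:~R * t))).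

Definition toeplitz (n : nat) (b : R -> R) : 'M[R[i]]_n :=
  \matrix_(j < n, k < n) fourier_coef b (j%:Z - k%:Z).

(* Roots of the characteristic polynomial, with multiplicity. *)
Definition char_roots (n : nat) (A : 'M[R[i]]_n) : seq R[i] :=
  sval (closed_field_poly_normal (char_poly A)).

(* Meant for Hermitian A (such as toeplitz n b, b being real-valued), whose
   eigenvalues are real: there complex.Re only changes their type. *)
Definition eigenvalues (n : nat) (A : 'M[R[i]]_n) : seq R :=
  sort <=%R (map (@complex.Re R) (char_roots A)).

(* 1-based: lambda 1 A is the smallest eigenvalue of A, lambda n A the largest. *)
Definition lambda (k n : nat) (A : 'M[R[i]]_n) : R :=
  nth 0 (eigenvalues A) k.-1.

(* All the exponents of `|t| are positive, hence symbol n 0 = 0. *)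
Definition symbol (n : nat) (t : R) : R :=
  let h : R := n%:R^-1 in
  \sum_(j < n) h `^ (j%:R * h) * `|t| `^ (2 - j%:R * h).

(* (s ^+ 2 - s) / ln s, extended by continuity at 0 and at 1. *)
Definition k2_integrand (s : R) : R :=
  if s == 0 then 0 else if s == 1 then 1 else (s ^+ 2 - s) / ln s.

Definition k2 : R :=
  pi^-1 * \int[@lebesgue_measure R]_(s in `[0, pi]) k2_integrand s.

End Toeplitz.

Arguments k2 R : clear implicits.

(* Main.v *)
Require Import Defs.
From mathcomp Require Import all_boot all_order all_algebra.
From mathcomp Require Import all_classical all_reals all_analysis.
From mathcomp Require Import measurable_realfun complex.
From mathcomp Require Import ring lra.

(** Lower bound.  If v is an eigenvector of the Toeplitz matrix of a symbol f, with
    eigenvalue z, then z |v|^2 is the mean over [-pi, pi] of f |p|^2, where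
    p(t) = sum_j v_j e^{-ijt} ([rayleigh]).  By Cauchy-Schwarz |p|^2 <= n |v|^2, while
    the mean of |p|^2 is |v|^2.  When f is a nondecreasing function of |t|, the mean
    of f against a density subject to these two constraints is least when the
    density equals its upper bound on [-pi/n, pi/n] and vanishes elsewhere
    ([bathtub]).  Hence lambda_1 >= (n / 2pi) int_{-pi/n}^{pi/n} f
    ([lambda1_toeplitz_ge]).

    The symbol f_n is an even sum of powers, and its rescaling
    n f_n(s/n) = (1/n) sum_{j<n} s^(2 - j/n) is a Riemann sum for
    int_0^1 s^(2-u) du = (s^2 - s) / ln s, the integrand of k2.  Summing the geometric
    progression shows that this Riemann sum is at least the integral minus 1/n,
    for every s >= 0 ([k2_integrand_le_riemann]).  Integrating over [0, pi] gives
    n lambda_1 >= k2 - 1/n for all n >= 1.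

    Numerical value.  The integrand int_0^1 s^(2-u) du is cut into four panels in u.
    On each panel the integral is a logarithmic mean, which Simpson's rule
    overestimates and Milne's open three-point rule underestimates, the fourth
    derivative of u |-> s^(2-u) being nonnegative.  Both rules only involve powers
    of s^(1/16), so integrating in s bounds k2 by rational combinations of powers
    of pi^(1/16) ([k2_quadrature_bounds]), and no logarithm is left.  Six decimals
    of pi, read off the partial sums of the cosine series, finish the estimate. *)

Set Implicit Arguments.
Unset Strict Implicit.
Unset Printing Implicit Defensive.

Import Order.TTheory GRing.Theory Num.Theory numFieldNormedType.Exports.

Local Open Scope classical_set_scope.
Local Open Scope ring_scope.

(** * Integrals of powers and of trigonometric functions *)

Section integrals.
Variable R : realType.
Implicit Types (a b c r s : R).
Local Notation mu := (@lebesgue_measure R).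

Lemma integrable_continuous (f : R -> R) (a b : R) : continuous f ->
  mu.-integrable `[a, b] (EFin \o f).
Proof.
move=> cf; apply: continuous_compact_integrable; first exact: segment_compact.
exact: continuous_subspaceT.
Qed.

Lemma integrable_mul_bounded d (T : measurableType d)
    (nu : {measure set T -> \bar R}) (D : set T) (f w : T -> R) (M : R) :
  measurable D -> nu.-integrable D (EFin \o f) -> measurable_fun D w ->
  (forall x, D x -> `|w x| <= M) ->
  nu.-integrable D (EFin \o (fun x => f x * w x)).
Proof.
move=> mD fint mw wM; have := integrableMl mD fint mw.
apply; exists M; split; first exact: num_real.
by move=> K MK x Dx; apply: le_trans (wM x Dx) (ltW MK).
Qed.

Lemma Rintegral_cst_itv (a b r : R) : a <= b ->
  \int[mu]_(_ in `[a, b]) r = r * (b - a).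
Proof.
move=> ab; rewrite Rintegral_cst//= lebesgue_measure_itv/= lte_fin.
by case: ltgtP ab => // -> _; rewrite subrr.
Qed.

Lemma Rintegral_sum_seq (I : Type) (r : seq I) (P : pred I) (f : I -> R -> R)
    (D : set R) : measurable D ->
  (forall i, P i -> mu.-integrable D (EFin \o f i)) ->
  \int[mu]_(x in D) (\sum_(i <- r | P i) f i x) =
  \sum_(i <- r | P i) \int[mu]_(x in D) f i x.
Proof.
move=> mD fi; elim: r => [|i r IH].
  under eq_Rintegral do rewrite big_nil.
  by rewrite Rintegral_cst// mul0r big_nil.
rewrite big_cons -IH; under eq_Rintegral do rewrite big_cons.
case: ifP => // Pi; rewrite RintegralD//; first exact: fi.
rewrite (_ : _ \o _ = fun x => (\sum_(j <- r | P j) (EFin \o f j) x)%E).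
  exact: integrable_sum.
by apply/funext => x /=; rewrite sumEFin.
Qed.

Lemma Rintegral_even (f : R -> R) (d : R) : 0 <= d -> continuous f ->
  (forall t, f (- t) = f t) ->
  \int[mu]_(t in `[- d, d]) f t = 2 * \int[mu]_(t in `[0, d]) f t.
Proof.
move=> d0 cf evenf.
have := @Rintegral_itvB R f (BLeft (- d)) (BRight d) 0.
rewrite !bnd_simp oppr_le0 d0 => /(_ (integrable_continuous _ _ cf) isT isT).
rewrite Rintegral_itv_obnd_cbnd; last first.
  apply: integrableS (integrable_continuous 0 d cf) => //.
  exact: subset_itv_oc_cc.
have -> : \int[mu]_(t in [set` Interval (BLeft (- d)) (BRight 0)]) f t =
          \int[mu]_(t in `[0, d]) f t.
  have := @integration_by_substitution_oppr R f 0 d d0.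
  rewrite oppr0 /Rintegral => ->; last exact: continuous_subspaceT.
  by congr fine; apply: eq_integral => t _ /=; rewrite evenf.
by move/eqP; rewrite subr_eq => /eqP ->; rewrite mulr_natl mulr2n.
Qed.

Lemma continuous_norm_powR a : 0 < a -> continuous (fun t : R => `|t| `^ a).
Proof.
move=> a0 t; have [->|t0] := eqVneq t 0; last first.
  apply: (@continuous_comp _ _ _ (fun u : R => `|u|) (fun s => s `^ a)).
    exact: norm_continuous.
  apply/differentiable_continuous/derivable1_diffP.
  by apply: derivable_powR; rewrite in_itv/= normr_gt0 t0.
rewrite /continuous_at normr0 powR0 ?gt_eqF//.
apply/cvgrPdist_lt => e e0.
have r0 : 0 < e `^ a^-1 by rewrite powR_gt0.
near=> u.
rewrite sub0r normrN ger0_norm ?powR_ge0//.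
have -> : e = (e `^ a^-1) `^ a by rewrite -powRrM mulVf ?gt_eqF// powRr1 ?ltW.
apply: gt0_ltr_powR; rewrite ?nnegrE ?powR_ge0//.
Unshelve. all: by end_near. Qed.

Lemma continuous_within_powR a b : 0 < a ->
  {within `[0, b], continuous (fun s : R => s `^ a)}.
Proof.
move=> a0.
apply: (@subspace_eq_continuous _ _ _ (fun s : R => `|s| `^ a)).
  by move=> s; rewrite inE/= in_itv/= => /andP[s0 _]; rewrite ger0_norm.
exact/continuous_subspaceT/continuous_norm_powR.
Qed.

Lemma integrable_powR a b : 0 < a ->
  mu.-integrable `[0, b] (EFin \o (fun s : R => s `^ a)).
Proof.
move=> a0; apply: continuous_compact_integrable; first exact: segment_compact.
exact: continuous_within_powR.
Qed.

Lemma Rintegral_powR a b : 0 < a -> 0 < b ->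
  \int[mu]_(s in `[0, b]) (s `^ a) = b `^ (a + 1) / (a + 1).
Proof.
move=> a0 b0; have a1 : 0 < a + 1 by rewrite addr_gt0.
pose F := fun s : R => (a + 1)^-1 * s `^ (a + 1).
have dF (x : R) : 0 < x -> is_derive x 1 F (x `^ a).
  move=> x0; have dp := @is_derive1_powR R (a + 1) x x0.
  have dZ := is_deriveZ (a + 1)^-1 dp.
  apply: (is_derive_eq dZ).
  by rewrite addrK /GRing.scale/= mulrA mulVf ?gt_eqF// mul1r.
rewrite /Rintegral (@continuous_FTC2 R _ F).
- by rewrite /F powR0 ?gt_eqF//= mulr0 oppr0 addr0 mulrC.
- by [].
- exact: continuous_within_powR.
- split.
  + move=> x; rewrite in_itv/= => /andP[x0 _].
    by have := dF x x0; case.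
  + rewrite /F powR0 ?gt_eqF//.
    by apply: cvgMr; exact: powR_cvg0.
  + apply: cvg_at_left_filter; apply: differentiable_continuous.
    by apply/derivable1_diffP; have := dF b b0; case.
- move=> x; rewrite in_itv/= => /andP[x0 _].
  by rewrite derive1E; have := dF x x0; case.
Qed.

Lemma Rintegral_is_derive (F f : R -> R) a b : a < b ->
  (forall t : R, is_derive t 1 F (f t)) -> continuous f ->
  \int[mu]_(t in `[a, b]) f t = F b - F a.
Proof.
move=> ab dF cf.
have cF : continuous F.
  move=> t; apply/differentiable_continuous/derivable1_diffP.
  by have := dF t; case.
rewrite /Rintegral (@continuous_FTC2 R f F)//.
- exact: continuous_subspaceT.
- split.
  + by move=> x _; have := dF x; case.
  + exact/cvg_at_right_filter/cF.
  + exact/cvg_at_left_filter/cF.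
- by move=> x _; rewrite derive1E; have := dF x; case.
Qed.

Lemma is_derive_mull (c t : R) : is_derive t 1 (fun u : R => c * u) c.
Proof.
have cD := is_deriveZ c (is_derive_id (t : R^o) (1 : R^o)).
by apply: (is_derive_eq cD); rewrite /GRing.scale/= mulr1.
Qed.

Lemma continuous_cosM (c : R) : continuous (fun t : R => cos (c * t)).
Proof.
move=> t; apply: continuous_comp; last exact: continuous_cos.
exact: mulrl_continuous.
Qed.

Lemma continuous_sinM (c : R) : continuous (fun t : R => sin (c * t)).
Proof.
move=> t; apply: continuous_comp; last exact: continuous_sin.
exact: mulrl_continuous.
Qed.

Lemma sinMpi (m : int) : sin (m%:~R * pi) = 0 :> R.
Proof.
have natcase (n : nat) : sin (n%:R * pi) = 0 :> R.
  elim: n => [|n IH]; first by rewrite mul0r sin0.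
  by rewrite -natr1 mulrDl mul1r sinDpi IH oppr0.
by case: m => n; rewrite ?NegzE ?mulrNz ?mulNr ?sinN -pmulrn natcase ?oppr0.
Qed.

Lemma Rintegral_cosM (m : int) :
  \int[mu]_(t in `[- pi, pi]) cos (m%:~R * t) = if m == 0 then 2 * pi else 0 :> R.
Proof.
have pi0 := pi_gt0 R.
have pi2 : - pi < pi :> R by lra.
case: eqVneq => [->|m0].
  under eq_Rintegral do rewrite mul0r cos0.
  by rewrite (Rintegral_cst_itv _ (ltW pi2)) mul1r opprK mulr_natl mulr2n.
have m_neq0 : (m%:~R : R) != 0 by rewrite intr_eq0.
pose F (t : R) := m%:~R^-1 * sin (m%:~R * t).
have dF (t : R) : is_derive t 1 F (cos (m%:~R * t)).
  have compD := is_derive1_comp (is_derive_sin (m%:~R * t)) (is_derive_mull m%:~R t).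
  have sD := is_deriveZ m%:~R^-1 compD.
  by apply: (is_derive_eq sD); rewrite /GRing.scale/=; field.
rewrite (Rintegral_is_derive pi2 dF (@continuous_cosM m%:~R)).
by rewrite /F mulrN sinN sinMpi oppr0 subrr.
Qed.

Lemma Rintegral_sinM (m : int) :
  \int[mu]_(t in `[- pi, pi]) sin (m%:~R * t) = 0 :> R.
Proof.
have pi0 := pi_gt0 R.
have pi2 : - pi < pi :> R by lra.
have [->|m0] := eqVneq m 0.
  under eq_Rintegral do rewrite mul0r sin0.
  by rewrite (Rintegral_cst_itv _ (ltW pi2)) mul0r.
have m_neq0 : (m%:~R : R) != 0 by rewrite intr_eq0.
pose F (t : R) := (- m%:~R^-1) * cos (m%:~R * t).
have dF (t : R) : is_derive t 1 F (sin (m%:~R * t)).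
  have compD := is_derive1_comp (is_derive_cos (m%:~R * t)) (is_derive_mull m%:~R t).
  have sD := is_deriveZ (- m%:~R^-1) compD.
  by apply: (is_derive_eq sD); rewrite /GRing.scale/=; field.
rewrite (Rintegral_is_derive pi2 dF (@continuous_sinM m%:~R)).
by rewrite /F mulrN cosN subrr.
Qed.

End integrals.

(** * Eigenvalues of Toeplitz matrices *)

Section spectral.
Variable R : realType.
Local Open Scope complex_scope.
Local Notation mu := (@lebesgue_measure R).
Local Notation Re := (@complex.Re R).
Local Notation Im := (@complex.Im R).

Lemma ReD (x y : R[i]) : Re (x + y) = Re x + Re y.
Proof. by case: x; case: y. Qed.

Lemma Re_sum (I : Type) (r : seq I) (P : pred I) (F : I -> R[i]) :
  Re (\sum_(i <- r | P i) F i) = \sum_(i <- r | P i) Re (F i).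
Proof. exact: (big_morph Re ReD erefl). Qed.

Lemma integrable_mul_cosM (f : R -> R) (c : R) :
  mu.-integrable `[- pi, pi] (EFin \o f) ->
  mu.-integrable `[- pi, pi] (EFin \o (fun t => f t * cos (c * t))).
Proof.
move=> intf; apply: (@integrable_mul_bounded _ _ _ mu _ f _ 1) => //.
  by apply: measurable_funTS; apply: continuous_measurable_fun; exact: continuous_cosM.
by move=> t _; exact: cos_max.
Qed.

Lemma integrable_mul_sinM (f : R -> R) (c : R) :
  mu.-integrable `[- pi, pi] (EFin \o f) ->
  mu.-integrable `[- pi, pi] (EFin \o (fun t => f t * sin (c * t))).
Proof.
move=> intf; apply: (@integrable_mul_bounded _ _ _ mu _ f _ 1) => //.
  by apply: measurable_funTS; apply: continuous_measurable_fun; exact: continuous_sinM.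
by move=> t _; exact: sin_max.
Qed.

Lemma fourier_coefE (f : R -> R) (m : int) :
  mu.-integrable `[- pi, pi] (EFin \o f) ->
  fourier_coef f m =
  ((2 * pi)^-1 * \int[mu]_(t in `[- pi, pi]) (f t * cos (m%:~R * t))) +i*
  (- ((2 * pi)^-1 * \int[mu]_(t in `[- pi, pi]) (f t * sin (m%:~R * t)))).
Proof.
move=> intf; rewrite /fourier_coef /Cintegral.
have -> : \int[mu]_(t in `[- pi, pi]) Re ((f t)%:C * cexpi (- (m%:~R * t))) =
          \int[mu]_(t in `[- pi, pi]) (f t * cos (m%:~R * t)).
  by apply: eq_Rintegral => t _; rewrite /= cosN mul0r subr0.
have -> : \int[mu]_(t in `[- pi, pi]) Im ((f t)%:C * cexpi (- (m%:~R * t))) =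
          - \int[mu]_(t in `[- pi, pi]) (f t * sin (m%:~R * t)).
  have intS := integrable_mul_sinM m%:~R intf.
  transitivity (\int[mu]_(t in `[- pi, pi]) (-1 * (f t * sin (m%:~R * t)))).
    by apply: eq_Rintegral => t _; rewrite /= sinN mul0r addr0 mulrN mulN1r.
  by rewrite RintegralZl// mulN1r.
by apply/eqP; rewrite eq_complex /= !mul0r subr0 addr0 mulrN !eqxx.
Qed.

Section trigonometric_polynomial.
Variables (n : nat) (v : 'rV[R[i]]_n).
Local Notation a j := (Re (v ord0 j)).
Local Notation b j := (Im (v ord0 j)).

Definition normsq : R := \sum_j (a j ^+ 2 + b j ^+ 2).

Definition trig_modsq_term (p : 'I_n * 'I_n) (t : R) : R :=
  (a p.1 * a p.2 + b p.1 * b p.2) * cos ((p.1%:Z - p.2%:Z)%:~R * t) +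
  (b p.1 * a p.2 - a p.1 * b p.2) * sin ((p.1%:Z - p.2%:Z)%:~R * t).

(** The squared modulus of p(t) = sum_j v_j e^{-ijt}, expanded as the double sum
    of Re (v_j conj(v_k) e^{-i(j-k)t}): in this form its integral against f is
    a combination of Fourier coefficients of f. *)
Definition trig_modsq (t : R) : R := \sum_(p : 'I_n * 'I_n) trig_modsq_term p t.

(* Real and imaginary parts of v_j e^{-ijt}. *)
Let re_mono t j := a j * cos (j%:R * t) + b j * sin (j%:R * t).
Let im_mono t j := b j * cos (j%:R * t) - a j * sin (j%:R * t).

Lemma trig_modsq_termE p t : trig_modsq_term p t =
  re_mono t p.1 * re_mono t p.2 + im_mono t p.1 * im_mono t p.2.
Proof.
rewrite /trig_modsq_term rmorphB mulrBl cosB sinB /re_mono /im_mono; ring.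
Qed.

Lemma sqr_re_im_mono t j : re_mono t j ^+ 2 + im_mono t j ^+ 2 = a j ^+ 2 + b j ^+ 2.
Proof.
have /(congr1 (fun z => (a j ^+ 2 + b j ^+ 2) * z)) := cos2Dsin2 (j%:R * t).
by rewrite mulr1 => <-; rewrite /re_mono /im_mono; ring.
Qed.

Lemma trig_modsqE t : trig_modsq t =
  (\sum_j re_mono t j) ^+ 2 + (\sum_j im_mono t j) ^+ 2.
Proof.
rewrite /trig_modsq; under eq_bigr do rewrite trig_modsq_termE.
rewrite big_split/= -(pair_bigA _ (fun i j => re_mono t i * re_mono t j)).
rewrite -(pair_bigA _ (fun i j => im_mono t i * im_mono t j))/= !expr2 !mulr_suml.
by congr (_ + _); apply: eq_bigr => i _; rewrite mulr_sumr.
Qed.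

Lemma trig_modsq_ge0 t : 0 <= trig_modsq t.
Proof. by rewrite trig_modsqE addr_ge0 ?sqr_ge0. Qed.

(** The Cauchy-Schwarz bound |p|^2 <= n |v|^2. *)
Lemma trig_modsq_le t : trig_modsq t <= n%:R * normsq.
Proof.
(* Twice a product is at most the sum of the squares, and the squares of the
   two parts of v_j e^{-ijt} add up to |v_j|^2. *)
pose s (j : 'I_n) := a j ^+ 2 + b j ^+ 2.
have bnd (p : 'I_n * 'I_n) : trig_modsq_term p t <= (s p.1 + s p.2) / 2.
  rewrite trig_modsq_termE /s -(sqr_re_im_mono t p.1) -(sqr_re_im_mono t p.2).
  have := sqr_ge0 (re_mono t p.1 - re_mono t p.2).
  have := sqr_ge0 (im_mono t p.1 - im_mono t p.2).
  by move: (re_mono t p.1) (re_mono t p.2) (im_mono t p.1) (im_mono t p.2) => *; lra.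
apply: (@le_trans _ _ (\sum_(p : 'I_n * 'I_n) (s p.1 + s p.2) / 2)).
  by apply: ler_sum => p _; exact: bnd.
rewrite -(pair_bigA _ (fun i j => (s i + s j) / 2))/=.
under eq_bigr => i _ do rewrite -mulr_suml big_split/= sumr_const card_ord -/normsq.
rewrite -mulr_suml big_split/= sumrMnl sumr_const card_ord -/normsq -(mulr_natl normsq n).
by move: (n%:R * normsq) => r; lra.
Qed.

Lemma measurable_trig_modsq D : measurable_fun D trig_modsq.
Proof.
apply: measurable_sum => p; apply: measurable_funD; apply: measurable_funM => //.
  by apply: measurable_funTS; apply: continuous_measurable_fun; exact: continuous_cosM.
by apply: measurable_funTS; apply: continuous_measurable_fun; exact: continuous_sinM.
Qed.

Lemma Rintegral_mul_trig_modsq (f : R -> R) :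
  mu.-integrable `[- pi, pi] (EFin \o f) ->
  \int[mu]_(t in `[- pi, pi]) (f t * trig_modsq t) = \sum_(p : 'I_n * 'I_n)
  ((a p.1 * a p.2 + b p.1 * b p.2) *
     \int[mu]_(t in `[- pi, pi]) (f t * cos ((p.1%:Z - p.2%:Z)%:~R * t)) +
  (b p.1 * a p.2 - a p.1 * b p.2) *
     \int[mu]_(t in `[- pi, pi]) (f t * sin ((p.1%:Z - p.2%:Z)%:~R * t))).
Proof.
move=> intf.
pose c (p : 'I_n * 'I_n) := a p.1 * a p.2 + b p.1 * b p.2.
pose s (p : 'I_n * 'I_n) := b p.1 * a p.2 - a p.1 * b p.2.
pose m (p : 'I_n * 'I_n) : R := (p.1%:Z - p.2%:Z)%:~R.
have intC p : mu.-integrable `[- pi, pi]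
    (EFin \o (fun t => c p * (f t * cos (m p * t)))).
  exact: (integrableZl _ (c p) (integrable_mul_cosM (m p) intf)).
have intS p : mu.-integrable `[- pi, pi]
    (EFin \o (fun t => s p * (f t * sin (m p * t)))).
  exact: (integrableZl _ (s p) (integrable_mul_sinM (m p) intf)).
transitivity (\int[mu]_(t in `[- pi, pi]) \sum_(p : 'I_n * 'I_n)
    (c p * (f t * cos (m p * t)) + s p * (f t * sin (m p * t)))).
  apply: eq_Rintegral => t _; rewrite mulr_sumr; apply: eq_bigr => p _.
  by rewrite /trig_modsq_term /c /s /m; ring.
rewrite Rintegral_sum_seq//; last by move=> p _; exact: integrableD (intC p) (intS p).
apply: eq_bigr => p _; rewrite RintegralD// !RintegralZl//.
  exact: integrable_mul_sinM.
exact: integrable_mul_cosM.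
Qed.

(** Parseval's identity for p. *)
Lemma Rintegral_trig_modsq : \int[mu]_(t in `[- pi, pi]) trig_modsq t = 2 * pi * normsq.
Proof.
have int1 : mu.-integrable `[- pi, pi] (EFin \o (fun _ : R => 1)).
  by apply: integrable_continuous => t; exact: cvg_cst.
transitivity (\int[mu]_(t in `[- pi, pi]) (1 * trig_modsq t)).
  by apply: eq_Rintegral => t _; rewrite mul1r.
rewrite (Rintegral_mul_trig_modsq int1).
transitivity (\sum_(p : 'I_n * 'I_n)
    (if p.2 == p.1 then 2 * pi * (a p.1 ^+ 2 + b p.1 ^+ 2) else 0)).
  apply: eq_bigr => -[j k] _ /=.
  have -> : \int[mu]_(t in `[- pi, pi]) (1 * cos ((j%:Z - k%:Z)%:~R * t)) =
      if k == j then 2 * pi else 0.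
    under eq_Rintegral do rewrite mul1r.
    by rewrite Rintegral_cosM subr_eq0 eqz_nat eq_sym.
  have -> : \int[mu]_(t in `[- pi, pi]) (1 * sin ((j%:Z - k%:Z)%:~R * t)) = 0.
    under eq_Rintegral do rewrite mul1r.
    exact: Rintegral_sinM.
  by case: eqVneq => [->|_]; ring.
rewrite -(pair_bigA _ (fun j k =>
  if k == j then 2 * pi * (a j ^+ 2 + b j ^+ 2) else 0))/= /normsq mulr_sumr.
by apply: eq_bigr => j _; rewrite -big_mkcond/= big_pred1_eq.
Qed.

(** The quadratic form of a Toeplitz matrix at v is the mean of its symbol against
    |p|^2, since averaging the symbol times e^{-i(j-k)t} over [-pi, pi] yields the entry
    (j, k). *)
Lemma rayleigh (f : R -> R) (z : R[i]) :
  mu.-integrable `[- pi, pi] (EFin \o f) ->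
  v *m toeplitz n f = z *: v ->
  Re z * normsq = (2 * pi)^-1 * \int[mu]_(t in `[- pi, pi]) (f t * trig_modsq t).
Proof.
move=> intf vz.
have normE : \sum_k v ord0 k * ((v ord0 k)^* )%C = normsq%:C.
  rewrite /normsq (big_morph (fun r : R => r%:C) (rmorphD _) (rmorph0 _)).
  apply: eq_bigr => k _; case: (v ord0 k) => x1 y1.
  by apply/eqP; rewrite eq_complex /=; apply/andP; split; apply/eqP; ring.
have -> : Re z * normsq = Re (\sum_k (z *: v) ord0 k * ((v ord0 k)^* )%C).
  under eq_bigr do rewrite mxE -mulrA.
  by rewrite -mulr_sumr normE; case: (z) => x1 y1 /=; rewrite mulr0 subr0.
rewrite -vz Re_sum (Rintegral_mul_trig_modsq intf) mulr_sumr.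
under eq_bigr do rewrite mxE mulr_suml Re_sum.
rewrite exchange_big pair_bigA /=.
apply: eq_bigr => -[j k] _ /=; rewrite mxE fourier_coefE//.
by case: (v ord0 j) => aj bj; case: (v ord0 k) => ak bk /=; ring.
Qed.

End trigonometric_polynomial.

(** Bathtub principle.  Replacing f by f - c changes both sides by the same amount,
    because w has the mass of the constant M on [-d, d]; and (f - c) w is
    nonnegative outside that interval and at least M (f - c) inside. *)
Lemma bathtub (f w : R -> R) (M c d : R) :
  mu.-integrable `[- pi, pi] (EFin \o f) ->
  measurable_fun (`[- pi, pi] : set R) w ->
  (forall t, 0 <= w t <= M) -> 0 <= d <= pi ->
  (forall t, `|t| <= d -> f t <= c) -> (forall t, d < `|t| -> c <= f t) ->
  \int[mu]_(t in `[- pi, pi]) w t = M * (2 * d) ->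
  M * \int[mu]_(t in `[- d, d]) f t <= \int[mu]_(t in `[- pi, pi]) (f t * w t).
Proof.
move=> intf mw w0M /andP[d0 dpi] f_le f_ge intw.
have intcst (k : R) : mu.-integrable `[- pi, pi] (EFin \o (fun _ : R => k)).
  by apply: integrable_continuous => t; exact: cvg_cst.
have w_norm t : `|w t| <= M by have /andP[w0 wM] := w0M t; rewrite ger0_norm.
have intfc : mu.-integrable `[- pi, pi] (EFin \o (fun t => f t - c)).
  exact: (integrableB _ intf (intcst c)).
have mul_int (g : R -> R) : mu.-integrable `[- pi, pi] (EFin \o g) ->
    mu.-integrable `[- pi, pi] (EFin \o (fun t => g t * w t)).
  by move=> intg; apply: (@integrable_mul_bounded _ _ _ mu _ g _ M).
have sub : ((`[- d, d] : set R) `<=` `[- pi, pi])%classic.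
  by apply: subset_itv; rewrite bnd_simp// lerN2.
have intfd : mu.-integrable `[- d, d] (EFin \o f) by exact: integrableS intf.
have intfcd : mu.-integrable `[- d, d] (EFin \o (fun t => f t - c)).
  exact: integrableS intfc.
have intMfcd : mu.-integrable `[- d, d] (EFin \o (fun t => M * (f t - c))).
  exact: (integrableZl _ M intfcd).
have intMfc_patch : mu.-integrable `[- pi, pi]
    (EFin \o (fun t => M * (f t - c)) \_ `[- d, d]).
  rewrite -restrict_EFin; apply/integrable_restrict => //.
  by rewrite setIidr.
(* The integrand on the left, extended by zero outside the central interval,
   lies below the one on the right: inside, f - c <= 0 and w <= M; outside,
   f - c >= 0 and w >= 0. *)
have main : \int[mu]_(t in `[- d, d]) (M * (f t - c)) <=
    \int[mu]_(t in `[- pi, pi]) ((f t - c) * w t).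
  rewrite -(setIidr sub) Rintegral_mkcondr; apply: le_Rintegral => //.
    exact: mul_int.
  move=> t _; rewrite patchE; have /andP[w0 wM] := w0M t.
  case: ifPn => tP.
    have : `|t| <= d by rewrite ler_norml; move: tP; rewrite inE/= in_itv.
    by move=> /f_le; rewrite -subr_le0 => fc; rewrite mulrC ler_wnM2l.
  rewrite mulr_ge0// subr_ge0; apply: f_ge; rewrite ltNge.
  by apply: contra tP => td; rewrite inE/= in_itv/= -ler_norml.
have intw' : mu.-integrable `[- pi, pi] (EFin \o w).
  have := mul_int _ (intcst 1); apply: eq_integrable => // t _.
  by rewrite /= mul1r.
have E1 : \int[mu]_(t in `[- pi, pi]) ((f t - c) * w t) =
    \int[mu]_(t in `[- pi, pi]) (f t * w t) - c * (M * (2 * d)).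
  transitivity (\int[mu]_(t in `[- pi, pi]) (f t * w t - c * w t)).
    by apply: eq_Rintegral => t _; rewrite mulrBl.
  rewrite RintegralB//; [|exact: mul_int|exact: (mul_int _ (intcst c))].
  by rewrite RintegralZl// intw.
have E2 : \int[mu]_(t in `[- d, d]) (M * (f t - c)) =
    M * \int[mu]_(t in `[- d, d]) f t - c * (M * (2 * d)).
  rewrite RintegralZl//.
  have intcd : mu.-integrable `[- d, d] (EFin \o (fun _ : R => c)).
    exact: integrableS (intcst c).
  rewrite RintegralB//.
  by rewrite Rintegral_cst_itv ?ge0_cp//; ring.
by move: main; rewrite E1 E2 lerD2r.
Qed.

Lemma lambda1_root n (A : 'M[R[i]]_n) : (0 < n)%N ->
  exists2 z, root (char_poly A) z & lambda 1 A = Re z.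
Proof.
move=> n0; have := svalP (closed_field_poly_normal (char_poly A)).
rewrite -/(char_roots A); set s := char_roots A => As.
have lead1 : lead_coef (char_poly A) = 1 by apply/monicP/char_poly_monic.
rewrite lead1 scale1r in As.
have ssize : size s = n.
  by apply: succn_inj; rewrite -(size_char_poly A) As size_prod_XsubC.
have : lambda 1 A \in eigenvalues A.
  by apply: mem_nth; rewrite size_sort size_map -/s ssize.
rewrite mem_sort => /mapP[z zs ->]; exists z => //.
by rewrite As root_prod_XsubC.
Qed.

Lemma normsq_gt0 n (v : 'rV[R[i]]_n) : v != 0 -> 0 < normsq v.
Proof.
move=> v0; have [j vj] : exists j, v ord0 j != 0.
  apply/existsP; apply: contraR v0 => /existsPn v0; apply/eqP/rowP => j.
  by rewrite mxE; apply/eqP; have := v0 j; rewrite negbK.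
rewrite /normsq (bigD1 j)//= ltr_wpDr//.
  by apply: sumr_ge0 => k _; rewrite addr_ge0 ?sqr_ge0.
rewrite lt_def addr_ge0 ?sqr_ge0// andbT.
rewrite paddr_eq0 ?sqr_ge0// !sqrf_eq0.
by move: vj; rewrite eq_complex.
Qed.

Lemma lambda1_toeplitz_ge n (f : R -> R) : (0 < n)%N ->
  mu.-integrable `[- pi, pi] (EFin \o f) ->
  (forall s t, `|s| <= `|t| -> f s <= f t) ->
  n%:R / (2 * pi) * \int[mu]_(t in `[- (pi / n%:R), pi / n%:R]) f t <=
  lambda 1 (toeplitz n f).
Proof.
move=> n0 intf fmono; have pi0 := pi_gt0 R.
have [z rz ->] := @lambda1_root n (toeplitz n f) n0.
have /eigenvalueP[v vz v0] : eigenvalue (toeplitz n f) z.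
  by rewrite eigenvalue_root_char.
have N0 := normsq_gt0 v0.
have n_gt0 : (0 : R) < n%:R by rewrite ltr0n.
have d_ge0 : 0 <= pi / n%:R :> R by rewrite divr_ge0 ?ltW.
rewrite -(ler_pM2r N0) (rayleigh intf vz) [n%:R / _]mulrC -!mulrA.
rewrite ler_pM2l ?invr_gt0 ?mulr_gt0// mulrCA mulrA.
rewrite [leLHS](_ : _ = n%:R * normsq v *
  \int[mu]_(t in `[- (pi / n%:R), pi / n%:R]) f t); last by ring.
(* The density trig_modsq v has mass 2 pi |v|^2 and is bounded by n |v|^2, so it
   fills exactly an interval of length 2 pi / n. *)
apply: (@bathtub f (trig_modsq v) _ (f (pi / n%:R))) => //.
- exact: measurable_trig_modsq.
- by move=> t; rewrite trig_modsq_ge0 trig_modsq_le.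
- by rewrite d_ge0 ler_pdivrMr// ler_peMr ?(ltW pi0)// ler1n.
- by move=> t td; apply: fmono; rewrite [leRHS]ger0_norm.
- by move=> t td; apply: fmono; rewrite [leLHS]ger0_norm// ltW.
- by rewrite Rintegral_trig_modsq; field; rewrite gt_eqF.
Qed.

End spectral.

(** * The symbol and its Riemann sum *)

Section symbol.
Variables (R : realType) (n : nat).
Hypothesis n0 : (0 < n)%N.
Local Notation mu := (@lebesgue_measure R).
Local Notation h := (n%:R^-1 : R).

Lemma exponent_gt0 (j : 'I_n) : 0 < 2 - j%:R * h.
Proof.
have n_gt0 : (0 : R) < n%:R by rewrite ltr0n.
have : j%:R * h <= 1 by rewrite ler_pdivrMr// mul1r ler_nat ltnW.
lra.
Qed.

Lemma symbol_term_continuous (j : 'I_n) :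
  continuous (fun t : R => h `^ (j%:R * h) * `|t| `^ (2 - j%:R * h)).
Proof.
move=> t; apply: cvgMr; apply: continuous_norm_powR; exact: exponent_gt0.
Qed.

Lemma symbol_mono (s t : R) : `|s| <= `|t| -> symbol n s <= symbol n t.
Proof.
move=> st; apply: ler_sum => j _; rewrite ler_wpM2l ?powR_ge0//.
by rewrite ge0_ler_powR ?nnegrE// ltW// exponent_gt0.
Qed.

Lemma integrable_symbol (a b : R) : mu.-integrable `[a, b] (EFin \o symbol n).
Proof.
rewrite (_ : _ \o _ = fun t => (\sum_(j < n)
  (EFin \o (fun t : R => h `^ (j%:R * h) * `|t| `^ (2 - j%:R * h))%R) t)%E).
  apply: integrable_sum => // j _; apply: integrable_continuous.
  exact: symbol_term_continuous.
by apply/funext => t /=; rewrite sumEFin.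
Qed.

(** The integral of the j-th term is 2 h^(jh) (pi h)^(3-jh) / (3 - jh), in which the
    powers of h combine to h^3 for every j. *)
Lemma Rintegral_symbol :
  \int[mu]_(t in `[- (pi / n%:R), pi / n%:R]) symbol n t =
  2 * h ^+ 3 * \sum_(j < n) pi `^ (3 - j%:R * h) / (3 - j%:R * h).
Proof.
have n_gt0 : (0 : R) < n%:R by rewrite ltr0n.
have h0 : 0 < h by rewrite invr_gt0.
have pi0 := pi_gt0 R.
have d0 : 0 < pi / n%:R :> R by rewrite divr_gt0.
rewrite /symbol Rintegral_sum_seq//; last first.
  by move=> j _; apply: integrable_continuous; exact: symbol_term_continuous.
rewrite mulr_sumr; apply: eq_bigr => j _.
have e0 := exponent_gt0 j.
rewrite Rintegral_even ?ltW//; [|exact: symbol_term_continuous|]; last first.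
  by move=> t; rewrite normrN.
transitivity (2 * \int[mu]_(t in `[0, pi / n%:R])
    (h `^ (j%:R * h) * t `^ (2 - j%:R * h))).
  congr (_ * _); apply: eq_Rintegral => t; rewrite inE/= in_itv/= => /andP[t0 _].
  by rewrite ger0_norm.
rewrite RintegralZl//; last exact: integrable_powR.
rewrite Rintegral_powR//.
have -> : 2 - j%:R * h + 1 = 3 - j%:R * h by ring.
rewrite powRM ?ltW//.
have -> : h ^+ 3 = h `^ (j%:R * h) * h `^ (3 - j%:R * h).
  rewrite -powRD; last by rewrite (gt_eqF h0) implybT.
  by rewrite addrC subrK -powR_mulrn// ltW.
by ring.
Qed.

(** With h = 1/n, the sum is a left Riemann sum for int_0^1 s^(2-u) du, which is the
    integrand of k2.  Both sides are explicit: with r = s^(-h), the sum is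
    s^2 (1 - s^-1) / (1 - r), so the comparison is between ln s and n (1 - r), and
    follows from 1 + y <= e^y at y = - h ln s or at y = h ln s, according to the
    sign of ln s. *)
Lemma k2_integrand_le_riemann (s : R) : 0 <= s ->
  k2_integrand s <= h * (\sum_(j < n) s `^ (2 - j%:R * h)) + h.
Proof.
have n_gt0 : (0 : R) < n%:R by rewrite ltr0n.
have h0 : 0 < h by rewrite invr_gt0.
rewrite le_eqVlt => /predU1P[<-|s0].
  rewrite /k2_integrand eqxx addr_ge0 ?(ltW h0)// mulr_ge0 ?(ltW h0)//.
  by apply: sumr_ge0 => j _; exact: powR_ge0.
have [->|s1] := eqVneq s 1.
  rewrite /k2_integrand oner_eq0 eqxx.
  under eq_bigr do rewrite powR1.
  by rewrite sumr_const card_ord mulVf ?gt_eqF// lerDl ltW.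
rewrite /k2_integrand gt_eqF// (negbTE s1).
pose y := - (h * ln s); pose r := s `^ (- h).
have rE : r = expR y by rewrite /r /powR gt_eqF// /y mulNr.
have r0 : 0 < r by rewrite powR_gt0.
have -> : \sum_(j < n) s `^ (2 - j%:R * h) = s ^+ 2 * \sum_(j < n) r ^+ j.
  rewrite mulr_sumr; apply: eq_bigr => j _.
  rewrite /r -[_ ^+ j]powR_mulrn ?powR_ge0// -powRrM -[s ^+ 2]powR_mulrn ?(ltW s0)//.
  by rewrite -powRD ?(gt_eqF s0) ?implybT//; congr (_ `^ _); ring.
have geo : s - s ^+ 2 = s ^+ 2 * (\sum_(j < n) r ^+ j) * (r - 1).
  have rn : r ^+ n = s^-1.
    rewrite /r -powR_mulrn ?powR_ge0// -powRrM mulNr mulVf ?gt_eqF//.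
    by rewrite powR_inv1// ltW.
  rewrite -mulrA [X in _ * X]mulrC -subrX1 rn; field.
  by rewrite gt_eqF.
set G := s ^+ 2 * _ in geo *.
have G0 : 0 <= G.
  by rewrite mulr_ge0 ?sqr_ge0// sumr_ge0// => j _; rewrite exprn_ge0 ?ltW.
have [s_lt1|s_gt1|/eqP] := ltgtP s 1; last by rewrite (negbTE s1).
(* For s < 1 the sum may fall short of the integral, but r - 1 <= y * r and
   s - s ^+ 2 <= 1 bound the deficit by h. *)
- have lns : ln s < 0 by rewrite ln_lt0// s0.
  have y0 : 0 < y by rewrite /y oppr_gt0 pmulr_rlt0.
  have r_le : r - 1 <= y * r.
    have := expR_ge1Dx (- y); rewrite expRN -rE => H.
    have : (1 - y) * r <= 1 by rewrite -ler_pdivlMr// div1r.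
    by rewrite mulrBl mul1r; lra.
  rewrite ler_ndivrMr//.
  have -> : (h * G + h) * ln s = - (y * G + y) by rewrite /y; ring.
  have ss : s - s ^+ 2 <= 1 by nra.
  have : G * (r - 1) <= G * (y * r) by rewrite ler_wpM2l.
  have : y * (s - s ^+ 2) <= y by rewrite ler_piMr// ltW.
  rewrite geo; lra.
(* For s > 1 it is a left sum of a decreasing function, hence at least the
   integral. *)
- have lns : 0 < ln s by rewrite ln_gt0.
  have r_ge : 1 + y <= r by rewrite rE expR_ge1Dx.
  rewrite ler_pdivrMr//.
  have : G * (1 - r) <= G * (h * ln s).
    by rewrite ler_wpM2l//; move: r_ge; rewrite /y; lra.
  have : 0 <= h * ln s by rewrite mulr_ge0 ?ltW.
  lra.
Qed.

End symbol.

(** * Quadrature bounds for the integrand of k2 *)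

Section quadrature.
Variable R : realType.
Implicit Types (a b q s u x y : R).
Local Notation mu := (@lebesgue_measure R).

Lemma is_derive_ge0_nondecreasing (f df : R -> R) :
  (forall x, 0 < x -> is_derive x 1 f (df x)) ->
  (forall x, 0 < x -> 0 <= df x) ->
  forall x y, 0 < x -> x <= y -> f x <= f y.
Proof.
move=> dfE df0 x y x0 xy.
have [] := @MVT_segment R f df x y xy.
- by move=> z; rewrite in_itv/= => /andP[xz _]; apply: dfE; exact: lt_trans xz.
- apply: derivable_within_continuous => z; rewrite in_itv/= => /andP[xz _].
  by have := dfE z (lt_le_trans x0 xz); case.
- move=> c; rewrite in_itv/= => /andP[xc _] E.
  rewrite -subr_ge0 E mulr_ge0 ?subr_ge0//; apply: df0; exact: lt_le_trans xc.
Qed.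

Lemma is_derive_quotient (f g : R -> R) x df dg : g x != 0 ->
  is_derive x 1 f df -> is_derive x 1 g dg ->
  is_derive x 1 (fun z => f z / g z) ((df * g x - f x * dg) / g x ^+ 2).
Proof.
move=> gx0 fD gD.
have qD := is_deriveM fD (is_deriveV gx0 gD).
apply: (is_derive_eq qD).
by rewrite /GRing.scale/=; field.
Qed.

(** The difference vanishes at 1, so its monotonicity gives Simpson's inequality
    for the logarithmic mean; its derivative is
    (z - 1)^4 / (z (z^2 + 4z + 1)^2). *)
Lemma ln_simpson_nondecreasing x y : 0 < x -> x <= y ->
  ln x - 3 * (x ^+ 2 - 1) / (x ^+ 2 + 4 * x + 1) <=
  ln y - 3 * (y ^+ 2 - 1) / (y ^+ 2 + 4 * y + 1).
Proof.
pose P : {poly R} := 3 *: ('X^2 - 1).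
pose Q : {poly R} := 'X^2 + 4 *: 'X + 1.
have PE z : P.[z] = 3 * (z ^+ 2 - 1) by rewrite /P !hornerE.
have QE z : Q.[z] = z ^+ 2 + 4 * z + 1 by rewrite /Q !hornerE.
rewrite -!PE -!QE.
have Q0 z : 0 < z -> 0 < Q.[z] by rewrite QE => z0; nra.
apply: (@is_derive_ge0_nondecreasing (fun z => ln z - P.[z] / Q.[z])
  (fun z => (z - 1) ^+ 4 / (z * Q.[z] ^+ 2))) => z z0; last first.
  by apply: divr_ge0; [exact: exprn_even_ge0|rewrite mulr_ge0 ?sqr_ge0 ?ltW].
have Qz : Q.[z] != 0 by rewrite gt_eqF ?Q0.
have zn0 : z != 0 by rewrite gt_eqF.
have quoD := is_derive_quotient Qz (is_derive_poly P z) (is_derive_poly Q z).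
have difD := is_deriveB (is_derive1_ln z0) quoD.
apply: (is_derive_eq difD).
have -> : P^`().[z] = 6 * z.
  by rewrite /P !(derivZ, derivB, derivXn, derivC, hornerE)/=; ring.
have -> : Q^`().[z] = 2 * z + 4.
  by rewrite /Q !(derivZ, derivD, derivX, derivXn, derivC, hornerE)/=; ring.
move: Qz; rewrite PE QE => Qz; field.
by rewrite Qz.
Qed.

(** The analogue for Milne's rule: the derivative is a positive multiple of
    (z - 1)^4 (3z^2 + z + 3). *)
Lemma ln_milne_nondecreasing x y : 0 < x -> x <= y ->
  3 * (x ^+ 4 - 1) / (4 * (2 * x ^+ 3 - x ^+ 2 + 2 * x)) - ln x <=
  3 * (y ^+ 4 - 1) / (4 * (2 * y ^+ 3 - y ^+ 2 + 2 * y)) - ln y.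
Proof.
pose P : {poly R} := 3 *: ('X^4 - 1).
pose Q : {poly R} := 4 *: (2 *: 'X^3 - 'X^2 + 2 *: 'X).
have PE z : P.[z] = 3 * (z ^+ 4 - 1) by rewrite /P !hornerE.
have QE z : Q.[z] = 4 * (2 * z ^+ 3 - z ^+ 2 + 2 * z).
  by rewrite /Q !hornerE.
rewrite -!PE -!QE.
have Q0 z : 0 < z -> 0 < Q.[z].
  move=> z0; rewrite QE.
  have -> : 2 * z ^+ 3 - z ^+ 2 + 2 * z = z * (z ^+ 2 + (z - 2^-1) ^+ 2 + 7 / 4).
    by field.
  by rewrite !mulr_gt0// addr_gt0 ?addr_ge0 ?sqr_ge0// ltr_wpDr ?sqr_ge0// exprn_gt0.
apply: (@is_derive_ge0_nondecreasing (fun z => P.[z] / Q.[z] - ln z)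
  (fun z => 8 * (z - 1) ^+ 4 * (3 * z ^+ 2 + z + 3) / Q.[z] ^+ 2)) => z z0; last first.
  apply: divr_ge0; last exact: sqr_ge0.
  apply: mulr_ge0; last by rewrite !addr_ge0 ?mulr_ge0 ?sqr_ge0// ltW.
  by apply: mulr_ge0 => //; exact: exprn_even_ge0.
have Qz : Q.[z] != 0 by rewrite gt_eqF ?Q0.
have zn0 : z != 0 by rewrite gt_eqF.
have quoD := is_derive_quotient Qz (is_derive_poly P z) (is_derive_poly Q z).
have difD := is_deriveB quoD (is_derive1_ln z0).
apply: (is_derive_eq difD).
have -> : P^`().[z] = 12 * z ^+ 3.
  by rewrite /P !(derivZ, derivB, derivXn, derivC, hornerE)/=; ring.
have -> : Q^`().[z] = 4 * (6 * z ^+ 2 - 2 * z + 2).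
  by rewrite /Q !(derivZ, derivD, derivN, derivX, derivXn, hornerE)/=; ring.
move: Qz; rewrite PE QE => Qz; field.
by rewrite zn0; move: Qz; rewrite mulf_eq0 negb_or => /andP[_ ->].
Qed.

(** Simpson's rule on [0, 1] overestimates the integral of w |-> (u^2)^w, the
    logarithmic mean of 1 and u^2. *)
Lemma logmean_le_simpson u : 0 < u -> u != 1 ->
  (u ^+ 2 - 1) / (2 * ln u) <= (u ^+ 2 + 4 * u + 1) / 6.
Proof.
move=> u0 /negP u1.
have D0 : 0 < u ^+ 2 + 4 * u + 1 by nra.
have [u_lt1|u_gt1|/eqP//] := ltgtP u 1.
- have lnu : ln u < 0 by rewrite ln_lt0// u0.
  have := ln_simpson_nondecreasing u0 (ltW u_lt1).
  rewrite ln1 expr1n subrr mulr0 mul0r subrr subr_le0 ler_pdivlMr// => H.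
  rewrite ler_ndivrMr; last by rewrite nmulr_llt0.
  rewrite -subr_ge0; move: H; rewrite -subr_ge0.
  by set L := ln u; nra.
- have lnu : 0 < ln u by rewrite ln_gt0.
  have := ln_simpson_nondecreasing (@ltr01 R) (ltW u_gt1).
  rewrite ln1 expr1n subrr mulr0 mul0r subrr subr_ge0 ler_pdivrMr// => H.
  rewrite ler_pdivrMr ?mulr_gt0//.
  by set L := ln u in H *; nra.
Qed.

(** Milne's open rule (2 g(1/4) - g(1/2) + 2 g(3/4)) / 3 underestimates the integral
    of g(w) = (u^4)^w over [0, 1], the logarithmic mean of 1 and u^4. *)
Lemma milne_le_logmean u : 0 < u -> u != 1 ->
  (2 * u ^+ 3 - u ^+ 2 + 2 * u) / 3 <= (u ^+ 4 - 1) / (4 * ln u).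
Proof.
move=> u0 /negP u1.
have D0 : 0 < 4 * (2 * u ^+ 3 - u ^+ 2 + 2 * u).
  have -> : 4 * (2 * u ^+ 3 - u ^+ 2 + 2 * u) =
    4 * u * (u ^+ 2 + (u - 1 / 2) ^+ 2 + 7 / 4) by field.
  by rewrite !mulr_gt0// ltr_wpDl ?addr_ge0 ?sqr_ge0// divr_gt0.
have [u_lt1|u_gt1|/eqP//] := ltgtP u 1.
- have lnu : ln u < 0 by rewrite ln_lt0// u0.
  have := ln_milne_nondecreasing u0 (ltW u_lt1).
  rewrite ln1 !expr1n subrr mulr0 mul0r subrr subr_le0 ler_pdivrMr// => H.
  rewrite ler_ndivlMr; last by rewrite nmulr_llt0.
  by set L := ln u in H *; lra.
- have lnu : 0 < ln u by rewrite ln_gt0.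
  have := ln_milne_nondecreasing (@ltr01 R) (ltW u_gt1).
  rewrite ln1 !expr1n subrr mulr0 mul0r subrr subr_ge0 ler_pdivlMr// => H.
  rewrite ler_pdivlMr ?mulr_gt0//.
  by set L := ln u in H *; lra.
Qed.

(** Four panels: s^2 - s = s (s - 1) with s = q^16 is
    q^16 (1 + q^4 + q^8 + q^12) (q^4 - 1), and the last factor divided by
    4 ln q = ln s / 4 is the logarithmic mean of 1 and q^4. *)
Lemma k2_integrand_expr16 q : 0 < q -> q != 1 ->
  k2_integrand (q ^+ 16) =
  q ^+ 16 * (1 + q ^+ 4 + q ^+ 8 + q ^+ 12) / 4 * ((q ^+ 4 - 1) / (4 * ln q)).
Proof.
move=> q0 q1.
have lnq : ln q != 0 by rewrite ln_eq0.
rewrite /k2_integrand gt_eqF ?exprn_gt0// pexpr_eq1 ?(ltW q0)//= (negbTE q1).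
rewrite lnXn// -[ln q *+ 16]mulr_natl.
have -> : (q ^+ 16) ^+ 2 - q ^+ 16 =
  q ^+ 16 * ((1 + q ^+ 4 + q ^+ 8 + q ^+ 12) * (q ^+ 4 - 1)) by ring.
by field.
Qed.

Lemma k2_integrand_ge q : 0 <= q ->
  q ^+ 16 * (1 + q ^+ 4 + q ^+ 8 + q ^+ 12) / 4 *
    ((2 * q ^+ 3 - q ^+ 2 + 2 * q) / 3) <= k2_integrand (q ^+ 16).
Proof.
rewrite le_eqVlt => /predU1P[<-|q0].
  by rewrite /k2_integrand !expr0n/= eqxx !mul0r.
have [->|q1] := eqVneq q 1.
  rewrite /k2_integrand !expr1n/= oner_eq0 eqxx; lra.
rewrite k2_integrand_expr16// ler_wpM2l ?milne_le_logmean//.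
by have q_ge0 := ltW q0; rewrite divr_ge0// mulr_ge0 ?exprn_ge0// !addr_ge0 ?exprn_ge0.
Qed.

Lemma k2_integrand_le q : 0 <= q ->
  k2_integrand (q ^+ 16) <= q ^+ 16 * (1 + q ^+ 4 + q ^+ 8 + q ^+ 12) / 4 *
    ((q ^+ 4 + 4 * q ^+ 2 + 1) / 6).
Proof.
rewrite le_eqVlt => /predU1P[<-|q0].
  by rewrite /k2_integrand !expr0n/= eqxx !mul0r.
have [->|q1] := eqVneq q 1.
  rewrite /k2_integrand !expr1n/= oner_eq0 eqxx; lra.
rewrite k2_integrand_expr16// ler_wpM2l//.
  by have q_ge0 := ltW q0; rewrite divr_ge0// mulr_ge0 ?exprn_ge0// !addr_ge0 ?exprn_ge0.
have := @logmean_le_simpson (q ^+ 2).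
rewrite exprn_gt0// pexpr_eq1 ?(ltW q0)// lnXn// -exprM => /(_ isT q1).
by rewrite -[ln q *+ 2]mulr_natl mulrA -natrM.
Qed.

Lemma k2_integrand_ge0 x : 0 <= x -> 0 <= k2_integrand x.
Proof.
rewrite /k2_integrand; case: eqVneq => // x0; case: eqVneq => // x1 x_ge0.
have xgt0 : 0 < x by rewrite lt_def x0.
have -> : x ^+ 2 - x = x * (x - 1) by ring.
have [x_lt1|x_gt1|/eqP] := ltgtP x 1; last by rewrite (negbTE x1).
- rewrite mulr_le0// ?invr_le0 ?ln_le0 ?(ltW x_lt1)//.
  by rewrite mulr_ge0_le0// subr_le0 ltW.
- by rewrite divr_ge0 ?ln_ge0 ?(ltW x_gt1)// mulr_ge0// subr_ge0 ltW.
Qed.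

Lemma measurable_inv : measurable_fun [set: R] (fun x : R => x^-1).
Proof.
(* Since 0^-1 = 0, the identity x^-1 = x |x|^-2 holds at 0 too. *)
rewrite (_ : (fun _ => _) = fun x : R => x * (`|x| `^ (-1)) ^+ 2); last first.
  apply/funext => x; rewrite powR_inv1// exprVn real_normK ?num_real// expr2.
  have [->|x0] := eqVneq x 0; first by rewrite !mul0r invr0.
  by field.
apply: measurable_funM => //; apply: measurable_funX.
exact: (measurableT_comp (@measurable_powR R (-1))).
Qed.

Lemma measurable_k2_integrand : measurable_fun [set: R] (@k2_integrand R).
Proof.
apply: measurable_fun_ifT => //.
  exact: measurable_fun_eqr.
apply: measurable_fun_ifT => //.
  exact: measurable_fun_eqr.
apply: measurable_funM.
  by apply: measurable_funB => //; exact: measurable_funX.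
exact: (measurableT_comp measurable_inv (@measurable_ln R)).
Qed.

Local Notation root16 s := (s `^ 16^-1).

Lemma root16K s : 0 <= s -> root16 s ^+ 16 = s.
Proof. by move=> s0; rewrite -powR_mulrn ?powR_ge0// -powRrM mulVf// powRr1. Qed.

Lemma root16_expr s k : root16 s ^+ k = s `^ (k%:R / 16).
Proof. by rewrite -powR_mulrn ?powR_ge0// -powRrM mulrC. Qed.

Lemma integrable_root16_term c k b : (0 < k)%N ->
  mu.-integrable `[0, b] (EFin \o (fun s => c * root16 s ^+ k)).
Proof.
move=> k0.
rewrite (_ : _ \o _ = fun s => (c%:E * (s `^ (k%:R / 16))%:E)%E); last first.
  by apply/funext => s /=; rewrite root16_expr.
by apply/integrableZl => //; apply: integrable_powR; rewrite divr_gt0// ltr0n.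
Qed.

Lemma integrable_root16_sum (l : seq (R * nat)) b :
  all (fun e => 0 < e.2)%N l ->
  mu.-integrable `[0, b] (EFin \o (fun s => \sum_(e <- l) e.1 * root16 s ^+ e.2)).
Proof.
move=> l0.
rewrite (_ : _ \o _ =
    fun s => (\sum_(e <- l | (0 < e.2)%N)
      (EFin \o (fun s => (e.1 * root16 s ^+ e.2)%R)) s)%E).
  by apply: integrable_sum => // -[c k] /= k0; exact: integrable_root16_term.
by apply/funext => s /=; rewrite -sumEFin -[in RHS]big_filter (all_filterP l0).
Qed.

Lemma Rintegral_root16_sum (l : seq (R * nat)) b : 0 < b ->
  all (fun e => 0 < e.2)%N l ->
  \int[mu]_(s in `[0, b]) (\sum_(e <- l) e.1 * root16 s ^+ e.2) =
  b * \sum_(e <- l) 16 * e.1 * root16 b ^+ e.2 / (e.2 + 16)%:R.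
Proof.
move=> b0 l0; have := l0 => /all_filterP <-.
rewrite big_filter mulr_sumr.
under eq_Rintegral do rewrite big_filter.
rewrite Rintegral_sum_seq//; last first.
  by move=> [c k] /= k0; exact: integrable_root16_term.
apply: eq_bigr => -[c k] /= k0.
have k16 : (0 : R) < k%:R / 16 by rewrite divr_gt0// ltr0n.
under eq_Rintegral do rewrite root16_expr.
rewrite RintegralZl//; last exact: integrable_powR.
rewrite Rintegral_powR// powRD; last by rewrite gt_eqF// addr_gt0.
rewrite powRr1 ?ltW// root16_expr natrD; field.
by rewrite -natrD pnatr_eq0 addn_eq0 andbF.
Qed.

(** Coefficients and exponents of the expansion of the lower bound of
    [k2_integrand_ge] as a polynomial in q. *)
Definition milne_terms : seq (R * nat) :=
  [:: (2 / 12, 17%N); (- 1 / 12, 18%N); (2 / 12, 19%N);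
      (2 / 12, 21%N); (- 1 / 12, 22%N); (2 / 12, 23%N);
      (2 / 12, 25%N); (- 1 / 12, 26%N); (2 / 12, 27%N);
      (2 / 12, 29%N); (- 1 / 12, 30%N); (2 / 12, 31%N)].

(** The same for the upper bound of [k2_integrand_le]. *)
Definition simpson_terms : seq (R * nat) :=
  [:: (1 / 24, 16%N); (4 / 24, 18%N); (2 / 24, 20%N); (4 / 24, 22%N);
      (2 / 24, 24%N); (4 / 24, 26%N); (2 / 24, 28%N); (4 / 24, 30%N);
      (1 / 24, 32%N)].

Lemma milne_terms_le s : 0 <= s ->
  \sum_(e <- milne_terms) e.1 * root16 s ^+ e.2 <= k2_integrand s.
Proof.
move=> s0; rewrite -[in leRHS](root16K s0).
apply: le_trans (k2_integrand_ge (powR_ge0 _ _)).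
rewrite /milne_terms !big_cons big_nil /=.
by set q := root16 s; rewrite le_eqVlt; apply/orP; left; apply/eqP; field.
Qed.

Lemma simpson_terms_ge s : 0 <= s ->
  k2_integrand s <= \sum_(e <- simpson_terms) e.1 * root16 s ^+ e.2.
Proof.
move=> s0; rewrite -[in leLHS](root16K s0).
apply: le_trans (k2_integrand_le (powR_ge0 _ _)) _.
rewrite /simpson_terms !big_cons big_nil /=.
by set q := root16 s; rewrite le_eqVlt; apply/orP; left; apply/eqP; field.
Qed.

Lemma integrable_k2_integrand b :
  mu.-integrable `[0, b] (EFin \o @k2_integrand R).
Proof.
have terms_pos : all (fun e => 0 < e.2)%N simpson_terms by [].
apply: le_integrable (integrable_root16_sum b terms_pos) => //.
  by apply/measurable_EFinP/measurable_funTS; exact: measurable_k2_integrand.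
move=> s /=; rewrite in_itv/= => /andP[s0 _].
have g0 := k2_integrand_ge0 s0; have gle := simpson_terms_ge s0.
by rewrite lee_fin ger0_norm// (le_trans gle)// ler_norm.
Qed.

Lemma k2_quadrature_bounds :
  \sum_(e <- milne_terms) 16 * e.1 * root16 pi ^+ e.2 / (e.2 + 16)%:R <= k2 R <=
  \sum_(e <- simpson_terms) 16 * e.1 * root16 pi ^+ e.2 / (e.2 + 16)%:R.
Proof.
have pi0 := pi_gt0 R; have pi_neq0 : (pi : R) != 0 by rewrite gt_eqF.
have strip l : all (fun e => 0 < e.2)%N l ->
    \sum_(e <- l) 16 * e.1 * root16 pi ^+ e.2 / (e.2 + 16)%:R =
    pi^-1 * \int[mu]_(s in `[0, pi]) (\sum_(e <- l) e.1 * root16 s ^+ e.2).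
  by move=> l0; rewrite Rintegral_root16_sum// mulKf.
rewrite !strip// /k2; apply/andP; split.
- rewrite ler_wpM2l ?invr_ge0 ?(ltW pi0)//; apply: le_Rintegral => //.
  + exact: integrable_root16_sum.
  + exact: integrable_k2_integrand.
  + by move=> s; rewrite /= in_itv/= => /andP[s0 _]; exact: milne_terms_le.
- rewrite ler_wpM2l ?invr_ge0 ?(ltW pi0)//; apply: le_Rintegral => //.
  + exact: integrable_k2_integrand.
  + exact: integrable_root16_sum.
  + by move=> s; rewrite /= in_itv/= => /andP[s0 _]; exact: simpson_terms_ge.
Qed.

End quadrature.

(** * Decimals of pi and of k2 *)

Section decimals.
Variable R : realType.
Implicit Types a b c s x : R.
Local Notation root16 s := (s `^ 16^-1).

(* The number whose integer part is a and whose decimals are the digits of b, c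
   and d, in groups of three. *)
Local Notation dec a b c d := (a + b / 10 ^+ 3 + c / 10 ^+ 6 + d / 10 ^+ 9).

Lemma cos_coeff'S x i :
  cos_coeff' x i.+1 = - (cos_coeff' x i * (x ^+ 2 / (i.*2.+1 * i.*2.+2)%:R)).
Proof.
rewrite /cos_coeff' -!exprnP exprS doubleS !factS 2!exprS !natrM.
have nz k : (k.+1%:R : R) != 0 by rewrite pnatr_eq0.
have f0 : (i.*2`!%:R : R) != 0 by rewrite pnatr_eq0 -lt0n fact_gt0.
rewrite expr2 !invfM.
by rewrite mulN1r !mulNr; congr (- _); ring.
Qed.

(** The terms of the cosine series alternate in sign and decrease in absolute value
    after the first one, so the error of a nonempty partial sum has the sign of
    the first omitted term. *)
Lemma lt_cos_partial_sum x n : (0 < n)%N -> 0 < x -> x <= 2 ->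
  0 < (-1) ^+ n * (cos x - \sum_(0 <= i < n) cos_coeff' x i).
Proof.
move=> n0 x0 x2.
have sgnE m : (-1) ^+ m * cos_coeff' x m = x ^+ m.*2 / m.*2`!%:R.
  by rewrite /cos_coeff' -exprnP !mulrA -expr2 sqrr_sign mul1r.
have cvf : series (fun i => (-1) ^+ n * cos_coeff' x i) t @[t --> \oo] -->
    (-1) ^+ n * cos x.
  rewrite (_ : series _ = (fun t => (-1) ^+ n * series (cos_coeff' x) t)).
    by apply: cvgMr; exact: cvg_cos_coeff'.
  by apply/funext => t; rewrite /series/= mulr_sumr.
rewrite mulrBr subr_gt0 mulr_sumr -(cvg_lim (@Rhausdorff R) cvf).
apply: lt_sum_lim_series; first exact: cvgP cvf.
move=> d /=; rewrite addnS cos_coeff'S -mulrDr.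
set m := (n + d.*2)%N.
have -> : (-1) ^+ n = (-1) ^+ m :> R.
  by rewrite exprD -mul2n exprM sqrrN !expr1n mulr1.
have m0 : (0 < m)%N by rewrite addn_gt0 n0.
rewrite -[X in X - _]mulr1 -mulrBr mulrA sgnE mulr_gt0//.
  by rewrite divr_gt0 ?exprn_gt0// ltr0n fact_gt0.
(* Here m >= 1, so the ratio x^2 / ((2m+1)(2m+2)) of consecutive terms is at most
   4 / 12. *)
have m1 : (1 : R) <= m%:R by rewrite ler1n.
have -> : (m.*2.+1 * m.*2.+2)%:R = (2 * m%:R + 1) * (2 * m%:R + 2) :> R.
  clearbody m; by rewrite natrM -[m.*2.+2]addn2 -[m.*2.+1]addn1 !natrD -[m.*2]mul2n natrM.
rewrite subr_gt0 ltr_pdivrMr; nra.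
Qed.

(** Cosine decreases on [0, pi] and vanishes at pi / 2, so it suffices to find its
    sign at the two bounds; eight and seven terms of the series do. *)
Lemma pi_half_bounds :
  dec 1 570 796 0 < (pi / 2 : R) < dec 1 570 796 500.
Proof.
have pi2 := pi_ge2 R.
have inpi (x : R) : 0 < x -> x <= 2 -> x \in `[0, pi].
  by move=> x0 x2; rewrite in_itv/= (ltW x0) (le_trans x2).
have half_in : (pi / 2 : R) \in `[0, pi].
  by rewrite in_itv/= divr_ge0 ?pi_ge0//= ler_pdivrMr// ler_peMr ?pi_ge0// ler1n.
have coef0 x : cos_coeff' x 0 = 1 by rewrite /cos_coeff' fact0 expr0 divr1 mulr1.
apply/andP; split.
- set y := (X in X < _).
  have y0 : 0 < y by rewrite /y; lra.
  have y2 : y <= 2 by rewrite /y; lra.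
  rewrite -(ltr_cos (inpi _ y0 y2) half_in) cos_pihalf.
  have := @lt_cos_partial_sum y 8 isT y0 y2.
  rewrite -signr_odd expr0 mul1r subr_gt0; apply: lt_trans.
  rewrite unlock /= !cos_coeff'S coef0 /double /= /y; lra.
- set y := (X in _ < X).
  have y0 : 0 < y by rewrite /y; lra.
  have y2 : y <= 2 by rewrite /y; lra.
  rewrite -(ltr_cos half_in (inpi _ y0 y2)) cos_pihalf.
  have := @lt_cos_partial_sum y 7 isT y0 y2.
  rewrite -signr_odd expr1 mulN1r oppr_gt0 subr_lt0 => /lt_trans; apply.
  rewrite unlock /= !cos_coeff'S coef0 /double /= /y; lra.
Qed.

Lemma le_root16 a s : 0 <= a -> 0 <= s -> a ^+ 16 <= s -> a <= root16 s.
Proof. by move=> a0 s0; rewrite -{1}(root16K s0) ler_pXn2r ?nnegrE ?powR_ge0. Qed.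

Lemma root16_le a s : 0 <= a -> 0 <= s -> s <= a ^+ 16 -> root16 s <= a.
Proof. by move=> a0 s0; rewrite -{1}(root16K s0) ler_pXn2r ?nnegrE ?powR_ge0. Qed.

(** The bounds are the sixteenth roots of 3.141592 and 3.141593, rounded outwards. *)
Lemma root16_pi_bounds :
  dec 1 74 167 130 <= root16 (pi : R) <= dec 1 74 167 160.
Proof.
have /andP[pi_lo pi_hi] := pi_half_bounds.
have pi_ge0 := pi_ge0 R.
apply/andP; split.
- by apply: le_root16; [lra|exact: pi_ge0|lra].
- by apply: root16_le; [lra|exact: pi_ge0|lra].
Qed.

Lemma lower_exprD a b c x m k : a <= x ^+ m -> b <= x ^+ k ->
  0 <= a -> 0 <= b -> c <= a * b -> c <= x ^+ (m + k).
Proof.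
by move=> am bk a0 b0 cab; rewrite exprD (le_trans cab)// ler_pM.
Qed.

Lemma upper_exprD a b c x m k : 0 <= x -> x ^+ m <= a -> x ^+ k <= b ->
  a * b <= c -> x ^+ (m + k) <= c.
Proof.
by move=> x0 ma kb abc; rewrite exprD (le_trans _ abc)// ler_pM ?exprn_ge0.
Qed.

(** The two quadrature sums at pi are 2.2945 - 4.45e-5 and 2.2945 - 4.04e-5; the
    rounded bounds on the powers of p = pi^(1/16), obtained by repeated
    multiplication by p^2, keep the lower one above 2.2945 - 5e-5. *)
Lemma k2_approx :
  `|k2 R - (2 + 2 / 10 + 9 / 10 ^+ 2 + 4 / 10 ^+ 3 + 5 / 10 ^+ 4)| <= 5 / 10 ^+ 5.
Proof.
have /andP[] := k2_quadrature_bounds R.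
have /andP[pi_lo pi_hi] := pi_half_bounds.
have /andP[l1 u1] := root16_pi_bounds.
have p16 := root16K (pi_ge0 R).
rewrite /milne_terms /simpson_terms !big_cons !big_nil /addn /=.
have p_ge0 : 0 <= root16 (pi : R) by exact: powR_ge0.
move: (root16 (pi : R)) p16 p_ge0 l1 u1 => p p16 p_ge0 l1 u1.
have l16 : dec 3 141 592 0 <= p ^+ 16 by rewrite p16; lra.
have u16 : p ^+ 16 <= dec 3 141 593 0 by rewrite p16; lra.
clear pi_lo pi_hi p16; rewrite -(expr1 p) in l1 u1.
move=> low high.
have u2 : p ^+ 2 <= dec 1 153 835 88 by apply: (upper_exprD p_ge0 u1 u1); clear; lra.
have u18 : p ^+ 18 <= dec 3 624 880 236 by apply: (upper_exprD p_ge0 u16 u2); clear; lra.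
have u20 : p ^+ 20 <= dec 4 182 514 7 by apply: (upper_exprD p_ge0 u18 u2); clear; lra.
have u22 : p ^+ 22 <= dec 4 825 931 418 by apply: (upper_exprD p_ge0 u20 u2); clear; lra.
have u24 : p ^+ 24 <= dec 5 568 329 3 by apply: (upper_exprD p_ge0 u22 u2); clear; lra.
have u26 : p ^+ 26 <= dec 6 424 933 386 by apply: (upper_exprD p_ge0 u24 u2); clear; lra.
have u28 : p ^+ 28 <= dec 7 413 313 579 by apply: (upper_exprD p_ge0 u26 u2); clear; lra.
have u30 : p ^+ 30 <= dec 8 553 741 326 by apply: (upper_exprD p_ge0 u28 u2); clear; lra.
have u32 : p ^+ 32 <= dec 9 869 606 876 by apply: (upper_exprD p_ge0 u30 u2); clear; lra.
rewrite ler_distl; apply/andP; split.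
- apply: le_trans low; clear high.
  have l2 : dec 1 153 835 23 <= p ^+ 2 by apply: (lower_exprD l1 l1); clear; lra.
  have l17 : dec 3 374 594 862 <= p ^+ 17 by apply: (lower_exprD l16 l1); clear; lra.
  have l19 : dec 3 893 725 740 <= p ^+ 19 by apply: (lower_exprD l17 l2); clear; lra.
  have l21 : dec 4 492 717 128 <= p ^+ 21 by apply: (lower_exprD l19 l2); clear; lra.
  have l23 : dec 5 183 854 370 <= p ^+ 23 by apply: (lower_exprD l21 l2); clear; lra.
  have l25 : dec 5 981 312 726 <= p ^+ 25 by apply: (lower_exprD l23 l2); clear; lra.
  have l27 : dec 6 901 448 106 <= p ^+ 27 by apply: (lower_exprD l25 l2); clear; lra.
  have l29 : dec 7 963 132 534 <= p ^+ 29 by apply: (lower_exprD l27 l2); clear; lra.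
  have l31 : dec 9 188 141 210 <= p ^+ 31 by apply: (lower_exprD l29 l2); clear; lra.
  clear u1 u2 u16 u20 u24 u28 u32 l1 l2 l16 p_ge0; lra.
- apply: le_trans high _; clear low l1 l16 u1 u2 p_ge0.
  lra.
Qed.

End decimals.

(** * The lower bound for the smallest eigenvalue *)

Section lower_bound.
Variables (R : realType) (n : nat).
Hypothesis n0 : (0 < n)%N.
Local Notation mu := (@lebesgue_measure R).

Lemma k2_le_riemann :
  k2 R <= n%:R^-1 / pi *
    (\sum_(j < n) pi `^ (3 - j%:R / n%:R) / (3 - j%:R / n%:R)) + n%:R^-1.
Proof.
have pi0 := pi_gt0 R.
have intj (j : 'I_n) : mu.-integrable `[0, pi]
    (EFin \o (fun s : R => s `^ (2 - j%:R / n%:R))).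
  by apply: integrable_powR => //; exact: exponent_gt0.
have ints : mu.-integrable `[0, pi]
    (EFin \o (fun s : R => \sum_(j < n) s `^ (2 - j%:R / n%:R))).
  rewrite (_ : _ \o _ = fun s => (\sum_(j < n)
    (EFin \o (fun s : R => s `^ (2 - j%:R / n%:R))%R) s)%E).
    exact: integrable_sum.
  by apply/funext => t /=; rewrite sumEFin.
have intk (k : R) : mu.-integrable `[0, pi] (EFin \o (fun _ : R => k)).
  by apply: integrable_continuous => t; exact: cvg_cst.
have inths : mu.-integrable `[0, pi]
    (EFin \o (fun s : R => n%:R^-1 * \sum_(j < n) s `^ (2 - j%:R / n%:R))).
  exact: (integrableZl _ n%:R^-1 ints).
have inthsh : mu.-integrable `[0, pi]
    (EFin \o (fun s : R => n%:R^-1 * (\sum_(j < n) s `^ (2 - j%:R / n%:R)) + n%:R^-1)).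
  exact: (integrableD _ inths (intk n%:R^-1)).
apply: (@le_trans _ _ (pi^-1 * \int[mu]_(s in `[0, pi])
    (n%:R^-1 * (\sum_(j < n) s `^ (2 - j%:R / n%:R)) + n%:R^-1))).
  rewrite /k2 ler_wpM2l ?invr_ge0 ?(ltW pi0)//; apply: le_Rintegral => //.
    exact: integrable_k2_integrand.
  by move=> s /=; rewrite in_itv/= => /andP[s0 _]; exact: k2_integrand_le_riemann.
rewrite RintegralD// RintegralZl// Rintegral_cst_itv ?(ltW pi0)//.
rewrite Rintegral_sum_seq//.
rewrite le_eqVlt; apply/orP; left; apply/eqP.
have -> : \sum_(j < n) \int[mu]_(s in `[0, pi]) s `^ (2 - j%:R / n%:R) =
    \sum_(j < n) pi `^ (3 - j%:R / n%:R) / (3 - j%:R / n%:R).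
  apply: eq_bigr => j _; rewrite Rintegral_powR//; last exact: exponent_gt0.
  by have -> : 2 - j%:R / n%:R + 1 = 3 - j%:R / n%:R :> R by ring.
have n_neq0 : (n%:R : R) != 0 by rewrite pnatr_eq0 -lt0n.
have pi_neq0 : (pi : R) != 0 by rewrite gt_eqF.
move: (\sum_(j < n) _) => S; move: (pi : R) (n%:R : R) pi_neq0 n_neq0 => p m p0 m0.
by field; rewrite p0 m0.
Qed.

Lemma mul_lambda1_ge :
  n%:R^-1 / pi * (\sum_(j < n) pi `^ (3 - j%:R / n%:R) / (3 - j%:R / n%:R)) <=
  n%:R * lambda 1 (toeplitz n (@symbol R n)).
Proof.
have pi0 := pi_gt0 R.
have n_gt0 : (0 : R) < n%:R by rewrite ltr0n.
have := lambda1_toeplitz_ge n0 (integrable_symbol n0 _ _) (@symbol_mono R n n0).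
rewrite -(ler_pM2l n_gt0) Rintegral_symbol//; apply: le_trans.
rewrite le_eqVlt; apply/orP; left; apply/eqP.
have n_neq0 : (n%:R : R) != 0 by rewrite gt_eqF.
have pi_neq0 : (pi : R) != 0 by rewrite gt_eqF.
move: (\sum_(j < n) _) => S; move: (pi : R) (n%:R : R) pi_neq0 n_neq0 => p m p0 m0.
by field; rewrite p0 m0.
Qed.

End lower_bound.

Theorem theorem2p2 (R : realType) :
  (exists C : R, exists N : nat, 0 < C /\
     forall n : nat, (N <= n)%N ->
       n%:R * lambda 1 (toeplitz n (@symbol R n)) >= k2 R - C / n%:R) /\
  `|k2 R - (2 + 2 / 10 + 9 / 10 ^+ 2 + 4 / 10 ^+ 3 + 5 / 10 ^+ 4)| <= 5 / 10 ^+ 5.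
Proof.
split; last exact: k2_approx.
exists 1, 1%N; split=> // n n0; rewrite div1r lerBlDr.
by apply: le_trans (k2_le_riemann R n0) _; rewrite lerD2r mul_lambda1_ge.
Qed.
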